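(* (1) If $\varphi$ is a symbol for $\mathcal{S}(\mathbb{R})$, then $C_\varphi:\mathcal{S}(\mathbb{R})\to\mathcal{S}(\mathbb{R})$, $f\mapsto f\circ\varphi$, is not supercyclic. (2) If $\varphi:\mathbb{R}\to\mathbb{R}$ is smooth and proper, then $C_\varphi:\mathcal{D}(\mathbb{R})\to\mathcal{D}(\mathbb{R})$, $f\mapsto f\circ\varphi$, is not supercyclic.
   Context: $\mathcal{S}(\mathbb{R})$ is the Schwartz space of smooth rapidly decreasing functions $f:\mathbb{R}\to\mathbb{C}$ with its usual Fréchet topology, given by the seminorms $\pi_n(f)=\sup_{x\in\mathbb{R}}\sup_{0\le j\le n}(1+|x|^2)^n|f^{(j)}(x)|$, $n\in\mathbb{N}$. $\mathcal{D}(\mathbb{R})$ is the space of compactly supported smooth functions with its natural (inductive limit) locally convex topology. A smooth function $\varphi:\mathbb{R}\to\mathbb{R}$ is a symbol for $\mathcal{S}(\mathbb{R})$ if $f\mapsto f\circ\varphi$ maps $\mathcal{S}(\mathbb{R})$ continuously into itself. A continuous function $\varphi:\mathbb{R}\to\mathbb{R}$ is proper if $\varphi^{-1}([-M,M])$ is bounded for each $M>0$. A linear operator $T$ on a locally convex space $X$ with scalar field $\mathbb{K}=\mathbb{C}$ is supercyclic if there exists $x\in X$ such that the projective orbit $\{\lambda T^n(x):\lambda\in\mathbb{K},\ n\in\mathbb{N}\}$ is dense in $X$. *)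

(* Defs.v *)
From HB Require Import structures.
From mathcomp Require Import all_boot all_order all_algebra.
From mathcomp Require Import complex.
From mathcomp Require Import all_classical all_reals all_analysis.
From mathcomp Require Import ring.

Set Implicit Arguments.
Unset Strict Implicit.
Unset Printing Implicit Defensive.

Import Order.TTheory GRing.Theory Num.Theory.
Import numFieldTopology.Exports numFieldNormedType.Exports.
Import Normc.

Local Open Scope complex_scope.
Local Open Scope ring_scope.
Local Open Scope classical_set_scope.

(* The locally convex topology on E whose neighbourhoods of x are the sets
   containing x + U for some U in the given system of absolutely convex
   absorbing sets. *)
HB.factory Record Lmodule_hasLocalBase (K : numFieldType) E
    & GRing.Lmodule K E := {
  base0 : set_system E;
  base0_neq0 : base0 !=set0;
  base0I : forall U V, base0 U -> base0 V ->
    exists2 W, base0 W & W `<=` U `&` V;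
  base0_convex : forall U, base0 U -> convex_set (U : set (convex_lmodType E));
  base0_balanced : forall U (a : K) u, base0 U -> `|a| <= 1 ->
    U u -> U (a *: u);
  base0_absorbing : forall U u, base0 U -> exists2 r : K, 0 < r & U (r *: u);
  base0_scale : forall U (a : K), base0 U ->
    exists2 W, base0 W & forall u, W u -> U (a *: u) }.

HB.builders Context K E & Lmodule_hasLocalBase K E.

Definition locNbhs (x : E) : set_system E :=
  [set A | exists2 U, base0 U & forall u, U u -> A (x + u)].

HB.instance Definition _ := hasNbhs.Build E locNbhs.

Let base0_convexE U (t : K) u v : base0 U -> 0 <= t <= 1 ->
  U u -> U v -> U (t *: u + (1 - t) *: v).
Proof.
move=> bU /andP[t0 t1] Uu Uv.
by apply/set_mem/(base0_convex bU (Itv01 t0 t1)); rewrite inE.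
Qed.

Let base00 U : base0 U -> U 0.
Proof.
move=> bU; have [r r0 Ur] := base0_absorbing 0 bU.
by rewrite -(scaler0 E r).
Qed.

Let base0D U : base0 U ->
  exists2 V, base0 V & forall u v, V u -> V v -> U (u + v).
Proof.
move=> bU; have [W bW WU] := base0_scale 2 bU; exists W => // u v Wu Wv.
have h01 : 0 <= (2^-1 : K) <= 1 by rewrite invr_ge0 ler0n invf_le1// ler1n.
have := base0_convexE bU h01 (WU _ Wu) (WU _ Wv).
have -> : 1 - 2^-1 = 2^-1 :> K by field.
by rewrite !scalerA mulVf// !scale1r.
Qed.

Let locNbhs_filter (p : E) : ProperFilter (nbhs p).
Proof.
apply: Build_ProperFilter_ex.
  by move=> A [U bU UA]; exists (p + 0); apply: UA; exact: base00.
split.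
- by have [U bU] := base0_neq0; exists U.
- move=> A B [U bU UA] [V bV VB]; have [W bW WUV] := base0I bU bV.
  by exists W => // u /WUV[Uu Vu]; split; [exact: UA|exact: VB].
- by move=> A B AB [U bU UA]; exists U => // u /UA /AB.
Qed.

Let locNbhs_singleton (p : E) (A : set E) : nbhs p A -> A p.
Proof. by move=> [U bU UA]; rewrite -(addr0 p); apply: UA; exact: base00. Qed.

Let locNbhs_nbhs (p : E) (A : set E) : nbhs p A -> nbhs p (nbhs^~ A).
Proof.
move=> [U bU UA]; have [V bV VU] := base0D bU; exists V => // u Vu.
by exists V => // v Vv; rewrite -addrA; apply: UA; exact: VU.
Qed.

HB.instance Definition _ := Nbhs_isNbhsTopological.Build E
  locNbhs_filter locNbhs_singleton locNbhs_nbhs.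

Let loc_add_continuous : continuous (fun x : E * E => x.1 + x.2).
Proof.
move=> [x y] A /= [U bU UA]; have [V bV VU] := base0D bU.
exists ([set x + u | u in V], [set y + u | u in V]).
  by split; exists V => // u Vu; exists u.
move=> [_ _] /= [[u Vu <-] [v Vv <-]].
by rewrite addrACA; apply: UA; exact: VU.
Qed.

Let loc_scale_continuous : continuous (fun z : K^o * E => z.1 *: z.2).
Proof.
move=> [a x] A /= [U bU UA]; have [V bV VU] := base0D bU.
have [r r0 Vr] := base0_absorbing x bV.
have M0 : 0 < `|a| + r by rewrite ltr_wpDl.
have [W bW WV] := base0_scale (`|a| + r) bV.
exists (ball (a : K^o) r, [set x + u | u in W]).
  by split; [exact: nbhsx_ballx|exists W => // u Wu; exists u].
move=> [b _] /= [+ [u Wu <-]]; rewrite -ball_normE /= => bar.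
have -> : b *: (x + u) = a *: x + (((b - a) / r) *: (r *: x) +
    (b / (`|a| + r)) *: ((`|a| + r) *: u)).
  rewrite !scalerA !divfK ?gt_eqF// addrA -scalerDl scalerDr.
  by congr (_ *: _ + _); rewrite addrC subrK.
apply/UA/VU.
  apply: base0_balanced => //.
  by rewrite normrM normfV (gtr0_norm r0) ler_pdivrMr// mul1r distrC ltW.
apply: base0_balanced => //; last exact: WV.
rewrite normrM normfV (gtr0_norm M0) ler_pdivrMr// mul1r.
rewrite -[b](subrK a) addrC (le_trans (ler_normD _ _))// lerD2l distrC.
exact: ltW.
Qed.

Let loc_locally_convex : exists2 B : set_system E,
  (forall b, b \in B -> convex_set b) & basis B.
Proof.
exists [set b | open b /\ convex_set b].
  by move=> b; rewrite inE => -[].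
split; first by move=> b [].
move=> x A [U bU UA].
exists ([set x + u | u in U]°); last first.
  by move=> y /interior_subset[u Uu <-]; exact: UA.
split; last by exists U => // u Uu; exists u.
split; first exact: open_interior.
move=> y z t; rewrite !inE => -[V bV Vy] [W bW Wz].
have [S bS SVW] := base0I bV bW; exists S => // s Ss.
have [Vs Ws] := SVW _ Ss.
have [u Uu yE] := Vy _ Vs; have [v Uv zE] := Wz _ Ws.
have t01 : 0 <= t%:num <= 1 by rewrite ge0 le1.
exists (t%:num *: u + (1 - t%:num) *: v); first exact: base0_convexE.
have sumE (p q w : E) : t%:num *: (w + p) + (1 - t%:num) *: (w + q) =
    w + (t%:num *: p + (1 - t%:num) *: q).
  by rewrite !scalerDr addrACA -scalerDl addrC addrCA subrr addr0 scale1r addrC.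
by rewrite -sumE yE zE ![_ + s]addrC sumE addrC.
Qed.

(* PreTopologicalLmod_isTvs only provides the uniform structure. *)
HB.instance Definition _ := PreTopologicalLmod_isTvs.Build K E
  loc_add_continuous loc_scale_continuous loc_locally_convex.
HB.instance Definition _ :=
  PreTopologicalNmodule_isTopologicalNmodule.Build E loc_add_continuous.
HB.instance Definition _ :=
  TopologicalNmodule_isTopologicalLmodule.Build K E loc_scale_continuous.
HB.instance Definition _ := Uniform_isTvs.Build K E loc_locally_convex.

HB.end.

(* f^`(n) is total; it is the genuine n-th derivative when f is smooth. *)
Definition smooth (R : realType) (f : R -> R) :=
  forall n x, derivable f^`(n) x 1.

(* Complex-valued functions are differentiated componentwise. *)
Definition csmooth (R : realType) (f : R -> R[i]) :=
  smooth (fun x => complex.Re (f x)) /\ smooth (fun x => complex.Im (f x)).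

Definition cderive1n (R : realType) n (f : R -> R[i]) : R -> R[i] :=
  fun x => (fun y => complex.Re (f y))^`(n) x
       +i* (fun y => complex.Im (f y))^`(n) x.

Section smooth_theory.
Context {R : realType}.
Implicit Types f g : R -> R.

Let nsmooth n f := forall k x, (k < n)%N -> derivable f^`(k) x 1.

Let smoothP f : smooth f <-> forall n, nsmooth n f.
Proof.
split=> [sf n k x _|sf n x]; first exact: sf.
exact: (sf n.+1).
Qed.

Let nsmoothW n f : nsmooth n.+1 f -> nsmooth n f.
Proof. by move=> sf k x kn; apply: sf; rewrite ltnW. Qed.

Let nsmoothSP n f :
  nsmooth n.+1 f <-> (forall x, derivable f x 1) /\ nsmooth n f^`().
Proof.
split=> [sf|[df sf] [|k] x kn //].
  split=> [x|k x kn]; first exact: (sf 0 x).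
  by rewrite -derive1Sn; exact: sf.
by rewrite derive1Sn; exact: sf.
Qed.

Let derive1D f g : (forall x, derivable f x 1) -> (forall x, derivable g x 1) ->
  (fun x => f x + g x)^`() = (fun x => f^`()%classic x + g^`()%classic x).
Proof. by move=> df dg; apply/funext => x; rewrite !derive1E deriveD. Qed.

Let derive1M f g : (forall x, derivable f x 1) -> (forall x, derivable g x 1) ->
  (fun x => f x * g x)^`() =
  (fun x => f^`()%classic x * g x + f x * g^`()%classic x).
Proof.
move=> df dg; apply/funext => x; rewrite !derive1E deriveM//.
by rewrite addrC mulrC [in RHS]mulrC; congr (_ + _); rewrite mulrC.
Qed.

Let nsmoothD n f g : nsmooth n f -> nsmooth n g ->
  nsmooth n (fun x => f x + g x).
Proof.
elim: n f g => [|n IH] f g; first by move=> _ _ k.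
move=> /nsmoothSP[df sf] /nsmoothSP[dg sg]; apply/nsmoothSP; split.
  by move=> x; exact: derivableD.
by rewrite derive1D//; apply: IH; [exact: sf|exact: sg].
Qed.

Let nsmoothM n f g : nsmooth n f -> nsmooth n g ->
  nsmooth n (fun x => f x * g x).
Proof.
elim: n f g => [|n IH] f g; first by move=> _ _ k.
move=> nf ng; have := nf; have := ng.
move=> /nsmoothSP[dg sg] /nsmoothSP[df sf]; apply/nsmoothSP; split.
  by move=> x; exact: derivableM.
rewrite derive1M//; apply: nsmoothD; apply: IH; first exact: sf.
- exact: (nsmoothW ng).
- exact: (nsmoothW nf).
- exact: sg.
Qed.

Let nsmooth_comp n f g : nsmooth n f -> nsmooth n g -> nsmooth n (f \o g).
Proof.
elim: n f => [|n IH] f; first by move=> _ _ k.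
move=> /nsmoothSP[df sf] ng; have /nsmoothSP[dg sg] := ng.
apply/nsmoothSP; split.
  move=> x; apply/derivable1_diffP/differentiable_comp.
    by apply/derivable1_diffP.
  by apply/derivable1_diffP.
rewrite [X in nsmooth n X](_ : _ =
    fun x => (f^`()%classic \o g) x * g^`()%classic x).
  by apply: nsmoothM; [apply: IH; [exact: sf|exact: (nsmoothW ng)]|exact: sg].
by apply/funext => x; rewrite derive1_comp.
Qed.

Lemma smoothD f g : smooth f -> smooth g -> smooth (fun x => f x + g x).
Proof.
by move=> /smoothP sf /smoothP sg; apply/smoothP => n; exact: nsmoothD.
Qed.

Lemma smooth_comp f g : smooth f -> smooth g -> smooth (f \o g).
Proof.
by move=> /smoothP sf /smoothP sg; apply/smoothP => n; exact: nsmooth_comp.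
Qed.

Lemma smooth_continuous f n : smooth f -> continuous f^`(n).
Proof. by move=> sf x; apply/differentiable_continuous/derivable1_diffP. Qed.

Lemma derive1n_cst (c : R) n x : (fun=> c : R)^`(n.+1) x = 0.
Proof.
elim: n x => [|n IH] x; first exact: derive1_cst.
by rewrite derive1nS (_ : _^`(n.+1) = cst 0) ?derive1_cst//; exact/funext.
Qed.

Lemma smooth_cst (c : R) : smooth (fun=> c).
Proof.
move=> [|n] x; first exact: derivable_cst.
by rewrite (_ : _^`(n.+1) = cst 0)//; apply/funext => y; exact: derive1n_cst.
Qed.

Lemma smoothZ (c : R) f : smooth f -> smooth (fun x => c * f x).
Proof.
move=> /smoothP sf; apply/smoothP => n; apply: nsmoothM => //.
by move: n; apply/smoothP; exact: smooth_cst.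
Qed.

Lemma derive1nD f g n : smooth f -> smooth g ->
  (fun x => f x + g x)^`(n) = (fun x => f^`(n)%classic x + g^`(n)%classic x).
Proof.
move=> sf sg; elim: n => [//|n IH].
by rewrite derive1nS IH derive1D.
Qed.

Lemma derive1nZ (c : R) f n : smooth f ->
  (fun x => c * f x)^`(n) = (fun x => c * f^`(n)%classic x).
Proof.
move=> sf; elim: n => [//|n IH]; rewrite derive1nS IH.
by apply/funext => x; rewrite derive1Ml.
Qed.

Implicit Types (u v : R -> R[i]) (a : R[i]).

Let ReZE a u : (fun x => complex.Re ((a *: u) x)) =
  (fun x => complex.Re a * complex.Re (u x) +
            (- complex.Im a) * complex.Im (u x)).
Proof.
apply/funext => x; rewrite -[(a *: u) x]/(a * u x).
by case: a (u x) => [? ?] [? ?] /=; rewrite mulNr.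
Qed.

Let ImZE a u : (fun x => complex.Im ((a *: u) x)) =
  (fun x => complex.Re a * complex.Im (u x) + complex.Im a * complex.Re (u x)).
Proof.
apply/funext => x; rewrite -[(a *: u) x]/(a * u x).
by case: a (u x) => [? ?] [? ?].
Qed.

Let ReDE u v : (fun x => complex.Re ((u + v) x)) =
  (fun x => complex.Re (u x) + complex.Re (v x)).
Proof.
apply/funext => x; rewrite -[(u + v) x]/(u x + v x).
by case: (u x) (v x) => [? ?] [? ?].
Qed.

Let ImDE u v : (fun x => complex.Im ((u + v) x)) =
  (fun x => complex.Im (u x) + complex.Im (v x)).
Proof.
apply/funext => x; rewrite -[(u + v) x]/(u x + v x).
by case: (u x) (v x) => [? ?] [? ?].
Qed.

Lemma csmooth0 : csmooth (0 : R -> R[i]).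
Proof. by split; exact: smooth_cst. Qed.

Lemma csmoothD u v : csmooth u -> csmooth v -> csmooth (u + v).
Proof.
by move=> [? ?] [? ?]; split; rewrite ?ReDE ?ImDE; exact: smoothD.
Qed.

Lemma csmoothZ a u : csmooth u -> csmooth (a *: u).
Proof.
by move=> [? ?]; split; rewrite ?ReZE ?ImZE; apply: smoothD; exact: smoothZ.
Qed.

Lemma csmooth_comp u g : csmooth u -> smooth g -> csmooth (u \o g).
Proof.
move=> [ru iu] sg.
by split; [exact: smooth_comp ru sg|exact: smooth_comp iu sg].
Qed.

Lemma cderive1n_0 n x : cderive1n n (0 : R -> R[i]) x = 0.
Proof.
by rewrite /cderive1n; case: n => [//|n]; rewrite !derive1n_cst.
Qed.

Lemma cderive1nD n u v x : csmooth u -> csmooth v ->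
  cderive1n n (u + v) x = cderive1n n u x + cderive1n n v x.
Proof.
move=> [ru iu] [rv iv].
by rewrite /cderive1n ReDE ImDE (derive1nD _ ru rv) (derive1nD _ iu iv).
Qed.

Lemma cderive1nZ n a u x : csmooth u ->
  cderive1n n (a *: u) x = a * cderive1n n u x.
Proof.
move=> [ru iu]; rewrite /cderive1n ReZE ImZE.
rewrite (derive1nD _ (smoothZ (c:=_) ru) (smoothZ (c:=_) iu)).
rewrite (derive1nD _ (smoothZ (c:=_) iu) (smoothZ (c:=_) ru)).
rewrite !(derive1nZ _ _ ru) !(derive1nZ _ _ iu).
by case: a => ? ? /=; rewrite mulNr.
Qed.

End smooth_theory.

Definition supercyclic (K : numFieldType) (X : tvsType K)
    (T : {linear X -> X}) : Prop :=
  exists x : X, dense [set l *: iter n T x | l in [set: K] & n in [set: nat]].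

(* sup over x and j <= n of w x * |f^(j) x|, possibly +oo. *)
Definition wsup (R : realType) (w : R -> R) n (f : R -> R[i]) : \bar R :=
  ereal_sup [set (w x * normc (cderive1n j f x))%:E |
               j in [set j | (j <= n)%N] & x in [set: R]].

Section wsup_theory.
Context {R : realType}.
Variable w : R -> R.
Hypothesis w0 : forall x, 0 <= w x.
Implicit Types (u v : R -> R[i]) (a b : R[i]) (e : R).

Lemma normc_ge0 a : 0 <= normc a.
Proof. by case: a => ? ?; exact: sqrtr_ge0. Qed.

Lemma normcE a : `|a| = (normc a)%:C.
Proof. by []. Qed.

Lemma wsup_ge j n u x : (j <= n)%N ->
  ((w x * normc (cderive1n j u x))%:E <= wsup w n u)%E.
Proof. by move=> jn; apply: ereal_sup_ubound; exists j => //; exists x. Qed.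

Lemma wsup_le n u (m : \bar R) :
  (forall j x, (j <= n)%N -> ((w x * normc (cderive1n j u x))%:E <= m)%E) ->
  (wsup w n u <= m)%E.
Proof. by move=> H; apply: ge_ereal_sup => _ /= [j jn [x _ <-]]; exact: H. Qed.

Lemma wsup_ge0 n u : (0 <= wsup w n u)%E.
Proof.
apply: le_trans (wsup_ge u 0 (leq0n n)).
by rewrite lee_fin mulr_ge0// normc_ge0.
Qed.

Lemma wsup_mono m n u : (m <= n)%N -> (wsup w m u <= wsup w n u)%E.
Proof.
by move=> mn; apply: wsup_le => j x jm; apply: wsup_ge; exact: leq_trans mn.
Qed.

Lemma wsup0 n : wsup w n (0 : R -> R[i]) = 0%E.
Proof.
apply/eqP; rewrite eq_le wsup_ge0 andbT; apply: wsup_le => j x _.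
by rewrite cderive1n_0 normc0 mulr0.
Qed.

Lemma wsupD n u v : csmooth u -> csmooth v ->
  (wsup w n (u + v)%R <= wsup w n u + wsup w n v)%E.
Proof.
move=> su sv; apply: wsup_le => j x jn; rewrite cderive1nD//.
apply: le_trans (leeD (wsup_ge u x jn) (wsup_ge v x jn)).
by rewrite -EFinD lee_fin -mulrDr ler_wpM2l// le_normcD.
Qed.

Lemma wsupZ n a u : csmooth u ->
  (wsup w n (a *: u)%R <= (normc a)%:E * wsup w n u)%E.
Proof.
move=> su; apply: wsup_le => j x jn; rewrite cderive1nZ//.
apply: (@le_trans _ _ ((normc a)%:E * (w x * normc (cderive1n j u x))%:E)%E).
  by rewrite -EFinM lee_fin normcM mulrCA.
by rewrite lee_wpmul2l ?lee_fin ?normc_ge0//; exact: wsup_ge.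
Qed.

Lemma wsup_lty n a u v : csmooth u -> csmooth v ->
  (wsup w n u < +oo)%E -> (wsup w n v < +oo)%E ->
  (wsup w n (a *: u + v)%R < +oo)%E.
Proof.
move=> su sv uy vy; apply: le_lt_trans (wsupD n (csmoothZ a su) sv) _.
rewrite lte_add_pinfty// (le_lt_trans (wsupZ _ _ _))//.
by rewrite lte_mul_pinfty// lee_fin normc_ge0.
Qed.

Lemma wsupZ_lt n a u e e' : csmooth u -> (wsup w n u < e%:E)%E ->
  normc a * e < e' -> (wsup w n (a *: u)%R < e'%:E)%E.
Proof.
move=> su ue ae; apply: le_lt_trans (wsupZ _ _ su) _.
apply: (@le_lt_trans _ _ ((normc a)%:E * e%:E)%E).
  by rewrite lee_wpmul2l ?lee_fin ?normc_ge0// ltW.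
by rewrite -EFinM lte_fin.
Qed.

Lemma wsup_convex n e (t : {i01 R[i]}) u v : csmooth u -> csmooth v ->
  (wsup w n u < e%:E)%E -> (wsup w n v < e%:E)%E ->
  (wsup w n (t%:num *: u + (1 - t%:num) *: v)%R < e%:E)%E.
Proof.
have [s [s0 s1 tE]] : exists s : R, [/\ 0 <= s, s <= 1 & t%:num = s%:C].
  exists (normc t%:num); rewrite normc_ge0; split=> //.
    by rewrite -lecR -normcE ger0_norm ?ge0// le1.
  by rewrite -normcE ger0_norm// ge0.
have nE (r : R) : 0 <= r -> normc r%:C = r.
  by move=> r0; rewrite /= expr0n /= addr0 sqrtr_sqr ger0_norm.
move=> su sv ue ve; rewrite tE -(rmorph1 (real_complex R)) -rmorphB.
apply: le_lt_trans (wsupD n (csmoothZ _ su) (csmoothZ _ sv)) _.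
apply: (@le_lt_trans _ _ (s%:E * wsup w n u + (1 - s)%:E * wsup w n v)%E).
  apply: leeD; (apply: le_trans (wsupZ _ _ _) _; first by []);
    by rewrite nE// subr_ge0.
have : wsup w n u \is a fin_num.
  by rewrite ge0_fin_numE ?wsup_ge0// (lt_trans ue)// ltry.
have : wsup w n v \is a fin_num.
  by rewrite ge0_fin_numE ?wsup_ge0// (lt_trans ve)// ltry.
move: (wsup w n u) (wsup w n v) ue ve => [p||] [q||]//.
rewrite !lte_fin => pe qe _ _.
have -> : e = s * e + (1 - s) * e by rewrite -mulrDl addrC subrK mul1r.
have [->|sN0] := eqVneq s 0; first by rewrite !mul0r !add0r subr0 !mul1r.
by rewrite ltr_leD// ?ltr_pM2l ?lt0r ?sN0// ler_wpM2l ?subr_ge0// ltW.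
Qed.

Lemma wsup_absorb n e u : csmooth u -> (wsup w n u < +oo)%E -> 0 < e ->
  exists2 r : R[i], 0 < r & (wsup w n (r *: u)%R < e%:E)%E.
Proof.
move=> su uy e0; set m := fine (wsup w n u).
have m0 : 0 <= m by rewrite fine_ge0// wsup_ge0.
have m2 : 0 < m + 2 by rewrite ltr_wpDl.
have um : (wsup w n u < (m + 1)%:E)%E.
  by rewrite -(@fineK _ (wsup w n u)) ?ge0_fin_numE ?wsup_ge0// lte_fin ltrDl.
exists (e / (m + 2))%:C; first by rewrite ltcR divr_gt0.
apply: (wsupZ_lt su um).
rewrite /= expr0n /= addr0 sqrtr_sqr ger0_norm; last by rewrite divr_ge0// ltW.
by rewrite mulrAC ltr_pdivrMr// ltr_pM2l// ltrD2l ltr1n.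
Qed.

End wsup_theory.

Definition schwartz_seminorm (R : realType) n (f : R -> R[i]) : \bar R :=
  wsup (fun x => (1 + `|x| ^+ 2) ^+ n) n f.

Definition is_schwartz (R : realType) (f : R -> R[i]) : Prop :=
  csmooth f /\ forall n, (schwartz_seminorm n f < +oo)%E.

Definition schwartz_pred (R : realType) : {pred R -> R[i]} :=
  fun f => `[< is_schwartz f >].

Record schwartz (R : realType) := Schwartz {
  schwartz_fun :> R -> R[i];
  _ : schwartz_fun \in @schwartz_pred R }.

Section schwartz_lmod.
Context {R : realType}.

HB.instance Definition _ := [isSub of schwartz R for @schwartz_fun R].
HB.instance Definition _ := [Choice of schwartz R by <:].

Let weight_ge0 n (x : R) : 0 <= (1 + `|x| ^+ 2) ^+ n.
Proof. by rewrite exprn_ge0// addr_ge0// exprn_ge0. Qed.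

Lemma schwartzP (f : schwartz R) : is_schwartz f.
Proof. by case: f => f /= /asboolP. Qed.

Let schwartz_submod_closed : submod_closed (@schwartz_pred R).
Proof.
split.
  apply/asboolP; split=> [|n]; first exact: csmooth0.
  by rewrite /schwartz_seminorm wsup0.
move=> a f g /asboolP[sf fy] /asboolP[sg gy]; apply/asboolP.
split=> [|n]; first by apply: csmoothD => //; exact: csmoothZ.
by apply: wsup_lty => //; [exact: fy|exact: gy].
Qed.

HB.instance Definition _ := GRing.isSubmodClosed.Build _ _ (@schwartz_pred R)
  schwartz_submod_closed.
HB.instance Definition _ := [SubChoice_isSubLmodule of schwartz R by <:].

(* The seminorms increase with n, so the balls of single seminorms already form
   a base at 0 of the Frechet topology. *)
Definition schwartz_base0 : set_system (schwartz R) :=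
  [set U | exists n, exists2 e : R, 0 < e &
     U = [set f : schwartz R | (schwartz_seminorm n f < e%:E)%E]].

Let base0_neq0 : schwartz_base0 !=set0.
Proof. by eexists; exists 0%N, 1. Qed.

Let base0I U V : schwartz_base0 U -> schwartz_base0 V ->
  exists2 W, schwartz_base0 W & W `<=` U `&` V.
Proof.
move=> [m [d d0 ->]] [n [e e0 ->]].
exists [set f : schwartz R |
    (schwartz_seminorm (maxn m n) f < (Num.min d e)%:E)%E].
  by exists (maxn m n), (Num.min d e) => //; rewrite lt_min d0.
have mono (k l : nat) (f : R -> R[i]) : (k <= l)%N ->
    (schwartz_seminorm k f <= schwartz_seminorm l f)%E.
  move=> kl; apply: le_trans (wsup_mono _ f kl).
  apply: wsup_le => j x jk; apply: le_trans (wsup_ge _ f x jk).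
  rewrite lee_fin ler_wpM2r ?normc_ge0//.
  by rewrite ler_weXn2l// lerDl exprn_ge0.
move=> f /=; rewrite EFin_min lt_min => /andP[fd fe]; split => /=.
  by apply: le_lt_trans fd; apply: mono; exact: leq_maxl.
by apply: le_lt_trans fe; apply: mono; exact: leq_maxr.
Qed.

Let base0_convex U : schwartz_base0 U ->
  convex_set (U : set (convex_lmodType (schwartz R))).
Proof.
move=> [n [e e0 ->]] f g t; rewrite !inE => fe ge.
have [sf _] := schwartzP f; have [sg _] := schwartzP g.
exact: (wsup_convex (weight_ge0 n) t sf sg fe ge).
Qed.

Let base0_scale U (a : R[i]) : schwartz_base0 U ->
  exists2 W, schwartz_base0 W & forall u, W u -> U (a *: u).
Proof.
move=> [n [e e0 ->]].
have a0 : 0 < normc a + 1 by rewrite ltr_wpDl// normc_ge0.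
exists [set f : schwartz R |
    (schwartz_seminorm n f < (e / (normc a + 1))%:E)%E].
  by exists n, (e / (normc a + 1)) => //; rewrite divr_gt0.
move=> f fe; have [sf _] := schwartzP f; apply: (wsupZ_lt sf fe).
by rewrite mulrCA gtr_pMr// ltr_pdivrMr// mul1r ltrDl.
Qed.

Let base0_balanced U (a : R[i]) u : schwartz_base0 U -> `|a| <= 1 ->
  U u -> U (a *: u).
Proof.
move=> [n [e e0 ->]] a1 ue; have [su _] := schwartzP u.
apply: le_lt_trans (wsupZ _ n a su) _; apply: le_lt_trans ue.
by rewrite gee_pMl// ?wsup_ge0// lee_fin -lecR -normcE.
Qed.

Let base0_absorbing U u : schwartz_base0 U ->
  exists2 r : R[i], 0 < r & U (r *: u).
Proof.
move=> [n [e e0 ->]]; have [su /(_ n) uy] := schwartzP u.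
by have [r r0 re] := wsup_absorb (weight_ge0 n) su uy e0; exists r.
Qed.

HB.instance Definition _ := Lmodule_hasLocalBase.Build R[i] (schwartz R)
  base0_neq0 base0I base0_convex base0_balanced base0_absorbing base0_scale.

Lemma schwartz_nbhsE (f : schwartz R) (A : set (schwartz R)) :
  nbhs f A <-> exists n, exists2 e : R, 0 < e &
    forall g : schwartz R, (schwartz_seminorm n g < e%:E)%E -> A (f + g).
Proof.
split=> [[_ [n [e e0 ->]] UA]|[n [e e0 UA]]].
  by exists n, e => // g /UA.
by exists [set f : schwartz R | (schwartz_seminorm n f < e%:E)%E];
  first exists n, e.
Qed.

Definition schwartz_comp (phi : R -> R)
    (h : forall f : schwartz R, is_schwartz (f \o phi)) (f : schwartz R) :
  schwartz R := Schwartz (asboolT (h f)).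

Let schwartz_comp_linear phi h : linear (@schwartz_comp phi h).
Proof. by move=> a f g; exact/val_inj. Qed.

HB.instance Definition _ phi h := GRing.isLinear.Build R[i] (schwartz R)
  (schwartz R) _ (@schwartz_comp phi h) (@schwartz_comp_linear phi h).

End schwartz_lmod.

Record schwartz_symbol (R : realType) (phi : R -> R) : Prop := SchwartzSymbol {
  symbol_smooth : smooth phi;
  symbol_comp : forall f : schwartz R, is_schwartz (f \o phi);
  symbol_continuous : continuous (schwartz_comp symbol_comp) }.

Definition csupport (R : realType) (f : R -> R[i]) : set R :=
  closure [set x | f x != 0].

Definition is_testfun (R : realType) (f : R -> R[i]) : Prop :=
  csmooth f /\ compact (csupport f).

Definition testfun_pred (R : realType) : {pred R -> R[i]} :=
  fun f => `[< is_testfun f >].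

Record testfun (R : realType) := Testfun {
  testfun_fun :> R -> R[i];
  _ : testfun_fun \in @testfun_pred R }.

Definition testfun_seminorm (R : realType) n (f : R -> R[i]) : \bar R :=
  wsup (fun=> 1) n f.

Definition proper_map (R : realType) (phi : R -> R) : Prop :=
  forall M : R, 0 < M -> bounded_set (phi @^-1` `[- M, M]).

Section testfun_theory.
Context {R : realType}.
Implicit Types (u v : R -> R[i]) (phi : R -> R).

Lemma csupportP u x : ~ csupport u x -> u x = 0.
Proof.
by move=> nx; apply: contra_notP nx => /eqP ux; exact: subset_closure.
Qed.

Lemma derive1n_outside (g : R -> R) (K : set R) n : closed K ->
  (forall x, ~ K x -> g x = 0) -> forall x, ~ K x -> g^`(n)%classic x = 0.
Proof.
move=> cK g0; elim: n => [//|n IH] x Kx.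
rewrite derive1nS derive1E (@near_eq_derive _ _ _ _ (cst 0)) ?derive_cst//.
have : nbhs x (~` K) by apply: open_nbhs_nbhs; split => //; exact: closed_openC.
by apply: filterS => y; exact: IH.
Qed.

Lemma derive1n_bounded (g : R -> R) (K : set R) n : compact K ->
  (forall x, ~ K x -> g x = 0) -> smooth g ->
  exists2 M, 0 <= M & forall x, `|g^`(n)%classic x| <= M.
Proof.
move=> cK g0 sg.
have clK : closed K by apply: compact_closed => //; exact: norm_hausdorff.
have /compact_bounded : compact (g^`(n) @` K).
  apply: continuous_compact => //; apply: continuous_subspaceT.
  exact: smooth_continuous.
move=> /pinfty_ex_gt0[M M0 HM]; exists M; first exact: ltW.
move=> x; have [Kx|nKx] := pselect (K x); first by apply: HM; exists x.
by rewrite (derive1n_outside _ clK g0)// normr0 ltW.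
Qed.

Lemma normc_le (a : R[i]) : normc a <= `|complex.Re a| + `|complex.Im a|.
Proof.
case: a => p q /=; rewrite -[leRHS]ger0_norm ?addr_ge0// -sqrtr_sqr.
rewrite ler_wsqrtr// sqrrD !real_normK ?num_real//.
by rewrite -addrA [leRHS]addrCA lerDr mulrn_wge0// mulr_ge0.
Qed.

Lemma is_testfun_lty u n : is_testfun u -> (testfun_seminorm n u < +oo)%E.
Proof.
move=> [[ru iu] cu].
have re0 x : ~ csupport u x -> complex.Re (u x) = 0.
  by move=> /csupportP ->.
have im0 x : ~ csupport u x -> complex.Im (u x) = 0.
  by move=> /csupportP ->.
have /boolp.choice[B HB] : forall j, exists b : R,
    0 <= b /\ forall x, normc (cderive1n j u x) <= b.
  move=> j.
  have [p p0 Hp] := derive1n_bounded j cu re0 ru.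
  have [q q0 Hq] := derive1n_bounded j cu im0 iu.
  exists (p + q); split; first exact: addr_ge0.
  by move=> x; apply: le_trans (normc_le _) _; exact: (lerD (Hp x) (Hq x)).
apply: (@le_lt_trans _ _ (\sum_(j < n.+1) B j)%:E); last exact: ltry.
apply: wsup_le => j x jn; rewrite mul1r lee_fin.
apply: le_trans (proj2 (HB j) x) _.
rewrite (bigD1 (inord j))//= inordK// lerDl.
by apply: sumr_ge0 => i _; have [] := HB i.
Qed.

Lemma is_testfun0 : is_testfun (0 : R -> R[i]).
Proof.
split; first exact: csmooth0.
rewrite /csupport (_ : [set _ | _] = set0) ?closure0; first exact: compact0.
by rewrite -subset0 => x /=; rewrite eqxx.
Qed.

Lemma is_testfunD u v : is_testfun u -> is_testfun v -> is_testfun (u + v).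
Proof.
move=> [su cu] [sv cv]; split; first exact: csmoothD.
apply: (subclosed_compact _ (compactU cu cv)); first exact: closed_closure.
rewrite -closureU; apply: closure_subset => x /=.
have [ux|] := eqVneq (u x) 0; last by left.
by rewrite -[(u + v) x]/(u x + v x) ux add0r; right.
Qed.

Lemma is_testfunZ (a : R[i]) u : is_testfun u -> is_testfun (a *: u).
Proof.
move=> [su cu]; split; first exact: csmoothZ.
apply: (subclosed_compact _ cu); first exact: closed_closure.
apply: closure_subset => x /=; rewrite -[(a *: u) x]/(a * u x).
by apply: contra_neq => ->; rewrite mulr0.
Qed.

Lemma is_testfun_comp u phi : is_testfun u -> smooth phi -> proper_map phi ->
  is_testfun (u \o phi).
Proof.
move=> [su cu] sphi pphi; split; first exact: csmooth_comp.
have cphi : continuous phi := smooth_continuous (n := 0) sphi.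
have clu : closed (csupport u) by exact: closed_closure.
have /pinfty_ex_gt0[M M0 HM] := compact_bounded cu.
have /pinfty_ex_gt0[N N0 HN] := pphi M M0.
apply: (subclosed_compact _ (segment_compact (a := - N) (b := N))).
  exact: closed_closure.
apply: (@subset_trans _ (phi @^-1` csupport u)).
  have -> : phi @^-1` csupport u = closure (phi @^-1` csupport u).
    by apply/closure_id; apply: preimage_closed => // x _; exact: cphi.
  by apply: closure_subset => x ux; exact: subset_closure.
move=> x /HM /= xM; rewrite in_itv /= -ler_norml; apply: HN => /=.
by rewrite in_itv /= -ler_norml.
Qed.

HB.instance Definition _ := [isSub of testfun R for @testfun_fun R].
HB.instance Definition _ := [Choice of testfun R by <:].

Lemma testfunP (f : testfun R) : is_testfun f.
Proof. by case: f => f /= /asboolP. Qed.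

Let testfun_submod_closed : submod_closed (@testfun_pred R).
Proof.
split; first exact/asboolP/is_testfun0.
move=> a f g /asboolP Tf /asboolP Tg; apply/asboolP.
by apply: is_testfunD => //; exact: is_testfunZ.
Qed.

HB.instance Definition _ := GRing.isSubmodClosed.Build _ _ (@testfun_pred R)
  testfun_submod_closed.
HB.instance Definition _ := [SubChoice_isSubLmodule of testfun R by <:].

(* Inductive limit topology: the neighbourhoods of 0 are generated by the
   convex balanced sets whose trace on each D_K, the test functions supported
   in the compact set K with the seminorms sup_{x, j <= n} |f^(j) x|, is a
   neighbourhood of 0. Such sets are automatically absorbing. *)
Definition testfun_base0 : set_system (testfun R) :=
  [set U | [/\ convex_set (U : set (convex_lmodType (testfun R))),
      forall (a : R[i]) f, `|a| <= 1 -> U f -> U (a *: f) &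
      forall K : set R, compact K -> exists n, exists2 e : R, 0 < e &
        forall f : testfun R, csupport f `<=` K ->
          (testfun_seminorm n f < e%:E)%E -> U f]].

Let base0_neq0 : testfun_base0 !=set0.
Proof.
exists setT; split=> [f g t|//|K _]; first by rewrite !inE.
by exists 0%N, 1.
Qed.

Let base0I U V : testfun_base0 U -> testfun_base0 V ->
  exists2 W, testfun_base0 W & W `<=` U `&` V.
Proof.
move=> [cU bU nU] [cV bV nV]; exists (U `&` V) => //; split.
- move=> f g t; rewrite !inE => -[Uf Vf] [Ug Vg]; split.
    by apply/set_mem/cU; rewrite inE.
  by apply/set_mem/cV; rewrite inE.
- by move=> a f a1 [Uf Vf]; split; [exact: bU|exact: bV].
- move=> K cK; have [m [d d0 Hd]] := nU K cK; have [n [e e0 He]] := nV K cK.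
  exists (maxn m n), (Num.min d e); first by rewrite lt_min d0.
  move=> f fK; rewrite EFin_min lt_min => /andP[fd fe]; split.
    apply: Hd => //; apply: le_lt_trans fd; apply: wsup_mono; exact: leq_maxl.
  apply: He => //; apply: le_lt_trans fe; apply: wsup_mono; exact: leq_maxr.
Qed.

Let base0_convex U : testfun_base0 U ->
  convex_set (U : set (convex_lmodType (testfun R))).
Proof. by case. Qed.

Let base0_balanced U (a : R[i]) (u : testfun R) :
  testfun_base0 U -> `|a| <= 1 -> U u -> U (a *: u).
Proof. by move=> [_ bU _]; exact: bU. Qed.

Let one_ge0 (x : R) : 0 <= (fun=> 1 : R) x. Proof. exact: ler01. Qed.

Let csupportZ (a : R[i]) u : csupport (a *: u) `<=` csupport u.
Proof.
apply: closure_subset => x /=; rewrite -[(a *: u) x]/(a * u x).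
by apply: contra_neq => ->; rewrite mulr0.
Qed.

Let base0_absorbing U (u : testfun R) : testfun_base0 U ->
  exists2 r : R[i], 0 < r & U (r *: u).
Proof.
move=> [_ _ nU]; have [su cu] := testfunP u.
have [n [e e0 He]] := nU _ cu.
have uy := is_testfun_lty n (testfunP u).
have [r r0 re] := wsup_absorb one_ge0 su uy e0; exists r => //.
by apply: He => //; exact: csupportZ.
Qed.

Let base0_scale U (a : R[i]) : testfun_base0 U ->
  exists2 W, testfun_base0 W & forall u : testfun R, W u -> U (a *: u).
Proof.
move=> [cU bU nU]; exists [set u | U (a *: u)] => //; split.
- move=> f g t; rewrite !inE /= => Uf Ug.
  rewrite (_ : a *: _ = conv t (a *: f : convex_lmodType (testfun R)) (a *: g)).
    by apply/set_mem/cU; rewrite inE.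
  by rewrite /conv /= scalerDr !scalerA ![a * _]mulrC.
- move=> b f b1 /= Uf; rewrite scalerA mulrC -scalerA; exact: bU.
- move=> K cK; have [n [e e0 He]] := nU K cK.
  have a0 : 0 < normc a + 1 by rewrite ltr_wpDl// normc_ge0.
  exists n, (e / (normc a + 1)); first by rewrite divr_gt0.
  move=> f fK fe; apply: He; first exact: subset_trans (@csupportZ _ _) fK.
  have [sf _] := testfunP f; apply: (wsupZ_lt sf fe).
  by rewrite mulrCA gtr_pMr// ltr_pdivrMr// mul1r ltrDl.
Qed.

HB.instance Definition _ := Lmodule_hasLocalBase.Build R[i] (testfun R)
  base0_neq0 base0I base0_convex base0_balanced base0_absorbing base0_scale.

Lemma testfun_nbhsE (f : testfun R) (A : set (testfun R)) :
  nbhs f A <-> exists2 U, testfun_base0 U & forall g, U g -> A (f + g).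
Proof. by []. Qed.

Definition testfun_comp phi (sphi : smooth phi) (pphi : proper_map phi)
    (f : testfun R) : testfun R :=
  Testfun (asboolT (is_testfun_comp (testfunP f) sphi pphi)).

Let testfun_comp_linear phi sphi pphi : linear (@testfun_comp phi sphi pphi).
Proof. by move=> a f g; exact/val_inj. Qed.

HB.instance Definition _ phi sphi pphi := GRing.isLinear.Build R[i] (testfun R)
  (testfun R) _ (@testfun_comp phi sphi pphi)
  (@testfun_comp_linear phi sphi pphi).

End testfun_theory.

(* Main.v *)
Require Import Defs.
From mathcomp Require Import all_boot all_order all_algebra complex.
From mathcomp Require Import all_classical all_reals all_analysis.
From mathcomp Require Import ring lra.

Set Implicit Arguments.
Unset Strict Implicit.
Unset Printing Implicit Defensive.

Import Order.TTheory GRing.Theory Num.Theory.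
Import numFieldTopology.Exports numFieldNormedType.Exports.
Import Normc.

Local Open Scope complex_scope.
Local Open Scope ring_scope.
Local Open Scope classical_set_scope.

(** Once phi is known to be continuous and proper, the only feature of the
topologies that matters is that each contains the topology of uniform convergence
on R, and the only feature of the spaces is that they contain the real smooth
functions of bounded support. So suppose that such functions b are all uniform
limits of multiples l * f o phi^n of one function f
([uniformly_approximates phi f]); this is impossible for a continuous proper phi.

- phi is injective ([approx_inj]). If phi a = phi b with a != b, every iterate
  f o phi^n with n > 0 takes the same value at a and b, so a function with
  values 1 and 0 there can only be approached by multiples of f itself. But
  multiples of f have a fixed ratio between their values at a and at a third
  point, while the functions to be approached do not.
- A continuous, proper and injective phi is surjective ([proper_inj_surj]): if
  phi omits a value, it tends to the same infinity at both ends of the line, and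
  the intermediate value theorem makes it take some value twice.
- If phi is surjective, then f o phi^n has the range of f, so every approximable
  function has, up to a scalar and a small error, one and the same range. This
  is false for a nonnegative bump and a difference of two disjoint bumps, whose
  range contains both 1 and -1 ([approx_nsurj]).

A symbol for the Schwartz space is proper because it pulls back a bump that is
positive on [-M, M] to a function that decays at infinity ([symbol_proper]).

The bumps come from the function exp (- 1 / x) on the positive half-line,
extended by 0. Its derivatives have the form p (1 / x) exp (- 1 / x) with p a
polynomial, and the family of all such functions is closed under
differentiation ([is_derive_flat]). *)

(** * Smooth bump functions *)

Section bump.
Context {R : realType}.
Implicit Types (p : {poly R}) (a r x t : R).

Lemma horner_smooth p : smooth (horner p).
Proof.
have hE n : (horner p)^`(n) = horner p^`(n)%R.
  by elim: n => [//|n IH]; rewrite derive1nS IH derivnS derivE.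
by move=> n x; rewrite hE; exact: derivable_horner.
Qed.

Lemma expR_ge_monomial n t : 0 <= t -> t ^+ n <= n`!%:R * expR t.
Proof.
case: n => [|n] t0; first by rewrite expr0 fact0 mul1r -expR0 ler_expR.
rewrite mulrC -ler_pdivrMr ?ltr0n ?fact_gt0//.
by apply: le_trans (expR_ge1Dxn n t0); rewrite lerDr.
Qed.

Lemma horner_expRN_bounded p :
  exists2 K, 0 <= K & forall t, 0 <= t -> `|p.[t] * expR (- t)| <= K.
Proof.
exists (\sum_(i < size p) `|p`_i| * i`!%:R).
  by apply: sumr_ge0 => i _; rewrite mulr_ge0.
move=> t t0; rewrite normrM (ger0_norm (expR_ge0 _)) expRN.
rewrite ler_pdivrMr ?expR_gt0// horner_coef mulr_suml.
apply: le_trans (ler_norm_sum _ _ _) _; apply: ler_sum => i _.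
rewrite normrM normrX (ger0_norm t0) -mulrA ler_wpM2l//.
exact: expR_ge_monomial.
Qed.

(** Keeping the polynomial as a parameter makes the family closed under
differentiation, also at the origin. *)
Definition flat p x : R := if 0 < x then p.[x^-1] * expR (- x^-1) else 0.

(** Near 0 a factor 1 / x only replaces p by p * 'X, and p (t) exp (- t) is
bounded for t >= 0. So flat functions are O(x), which gives both their
continuity at 0 and, applied to p * 'X, their derivative there. *)
Lemma flat_le p : exists2 K, 0 <= K & forall x, `|flat p x| <= K * `|x|.
Proof.
have [K K0 HK] := horner_expRN_bounded (p * 'X).
exists K => // x; rewrite /flat; case: ifPn => [x0|_]; last first.
  by rewrite normr0 mulr_ge0.
have := HK x^-1; rewrite hornerMX invr_ge0 (ltW x0) => /(_ isT).
by rewrite mulrAC normrM normfV ler_pdivrMr ?normr_gt0 ?gt_eqF.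
Qed.

(** The factor of exp (- 1 / x) in the derivative of p (1 / x) exp (- 1 / x), as
a polynomial in 1 / x. *)
Definition flat_deriv p : {poly R} := (p - p^`()%R) * 'X^2.

Lemma is_derive_flat p x : is_derive x 1 (flat p) (flat (flat_deriv p) x).
Proof.
have [x0|x0|->] := ltgtP x 0.
- rewrite [X in is_derive _ _ _ X](_ : _ = 0); last by rewrite /flat ltNge ltW.
  apply: (@near_eq_is_derive _ _ _ (cst 0)).
  by near=> y; rewrite /flat ltNge ltW//; near: y; exact: lt_nbhsl.
- apply: (@near_eq_is_derive _ _ _ (fun y : R => p.[y^-1] * expR (- y^-1) : R)).
    by near=> y; rewrite /flat ifT//; near: y; exact: lt_nbhsr.
  have xN0 : x != 0 by rewrite gt_eqF.
  have dV : is_derive x 1 (fun y : R => y^-1) (- x ^- 2).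
    apply: is_derive_eq; first exact: (@is_deriveV _ id).
    by rewrite /GRing.scale /= mulr1.
  have dp : is_derive x^-1 1 (horner p) p^`()%R.[x^-1].
    apply: DeriveDef; first exact: derivable_horner.
    by rewrite -derive1E -derivE.
  have dNV : is_derive x 1 (fun y : R => - y^-1) (- (- x ^- 2)).
    exact: is_deriveN.
  have d1 := @is_derive1_comp _ (horner p) (fun y : R => y^-1) x _ _ dp dV.
  have d2 := @is_derive1_comp _ expR (fun y : R => - y^-1) x _ _
     (is_derive_expR _) dNV.
  apply: (is_derive_eq (is_deriveM d1 d2)).
  rewrite /flat x0 /flat_deriv !hornerE /GRing.scale /=.
  by field.
- rewrite [X in is_derive _ _ _ X](_ : _ = 0); last by rewrite /flat ltxx.
  have [K K0 HK] := flat_le (p * 'X).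
  have cvg0 : (fun h : R => h^-1 *: ((flat p \o shift 0) (h *: 1) - flat p 0))
       h @[h --> 0^'] --> (0 : R).
    apply/cvgr0Pnorm_le => e e0; near=> h.
    have hN0 : h != 0 by near: h; exact: nbhs_dnbhs_neq.
    rewrite /= /flat ltxx subr0 addr0 /GRing.scale /= mulr1 -/(flat p h).
    (* The difference quotient at 0 is again a flat function. *)
    have -> : h^-1 * flat p h = flat (p * 'X) h.
      by rewrite /flat; case: ifP => _; rewrite ?mulr0// hornerMX; ring.
    apply: le_trans (HK h) _.
    apply: (@le_trans _ _ ((K + 1) * `|h|)); first by rewrite ler_wpM2r ?lerDl.
    rewrite mulrC -ler_pdivlMr ?ltr_wpDl// ltW//.
    by near: h; apply: dnbhs0_lt; rewrite divr_gt0// ltr_wpDl.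
  by apply: DeriveDef; [apply/cvg_ex; exists 0|exact: cvg_lim].
Unshelve. all: by end_near. Qed.

Lemma flat_smooth p : smooth (flat p).
Proof.
have fE n : (flat p)^`(n) = flat (iter n flat_deriv p).
  elim: n => [//|n IH]; rewrite derive1nS IH; apply/funext => x.
  by rewrite derive1E; have /@derive_val := is_derive_flat (iter n flat_deriv p) x.
by move=> n x; rewrite fE; have /@ex_derive := is_derive_flat (iter n flat_deriv p) x.
Qed.

Lemma flat1_ge0 x : 0 <= flat 1 x.
Proof. by rewrite /flat; case: ifP; rewrite // hornerC mul1r expR_ge0. Qed.

Lemma flat1_gt0 x : 0 < x -> 0 < flat 1 x.
Proof. by rewrite /flat => ->; rewrite hornerC mul1r expR_gt0. Qed.

Lemma flat1_le : {homo flat 1 : x y / x <= y}.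
Proof.
move=> x y xy; have [x0|x0] := ltP 0 x; last first.
  by rewrite {1}/flat ltNge x0 flat1_ge0.
have y0 := lt_le_trans x0 xy; rewrite /flat x0 y0 !hornerC !mul1r.
by rewrite ler_expR lerN2 lef_pV2.
Qed.

Definition bumpfun a r x : R :=
  (flat 1 (r ^+ 2))^-1 * flat 1 (r ^+ 2 - (x - a) ^+ 2).

Lemma bump_smooth a r : smooth (bumpfun a r).
Proof.
apply: smoothZ; rewrite (_ : (fun _ => _) =
  flat 1 \o horner ((r ^+ 2)%:P - ('X - a%:P) ^+ 2)).
  by apply: smooth_comp; [exact: flat_smooth|exact: horner_smooth].
by apply/funext => x; rewrite /= !hornerE.
Qed.

Lemma bump_center a r : 0 < r -> bumpfun a r a = 1.
Proof.
move=> r0; rewrite /bumpfun subrr expr0n subr0 mulVf// gt_eqF//.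
by rewrite flat1_gt0// exprn_gt0.
Qed.

Lemma bump_ge0 a r x : 0 <= bumpfun a r x.
Proof. by rewrite mulr_ge0 ?invr_ge0 ?flat1_ge0. Qed.

Lemma bump_le1 a r x : 0 < r -> bumpfun a r x <= 1.
Proof.
move=> r0; rewrite /bumpfun mulrC ler_pdivrMr ?flat1_gt0 ?exprn_gt0// mul1r.
by apply: flat1_le; rewrite lerBlDr lerDl sqr_ge0.
Qed.

Lemma bump_gt0 a r x : `|x - a| < r -> 0 < bumpfun a r x.
Proof.
move=> xr; have r0 := le_lt_trans (normr_ge0 _) xr.
rewrite mulr_gt0 ?invr_gt0 ?flat1_gt0 ?exprn_gt0//.
by rewrite subr_gt0 -real_normK ?num_real// ltrXn2r// ?nnegrE// ltW.
Qed.

Lemma bump_out a r x : 0 <= r -> r <= `|x - a| -> bumpfun a r x = 0.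
Proof.
move=> r0 xr; rewrite /bumpfun {2}/flat ltNge subr_le0.
by rewrite -[leRHS]real_normK ?num_real// lerXn2r ?nnegrE//= mulr0.
Qed.

End bump.

(** * Uniform approximation by multiples of iterates *)

Section approximation.
Context {R : realType}.
Implicit Types (phi b : R -> R) (z : R[i]) (r e : R).

Definition bounded_support b := exists M, forall x, M <= `|x| -> b x = 0.

(** What supercyclicity of f leaves when the topology is weakened to uniform
convergence and only real targets of bounded support are considered. *)
Definition uniformly_approximates phi (f : R -> R[i]) := forall b e,
  smooth b -> bounded_support b -> 0 < e ->
  exists l n, forall x, normc (l * f (iter n phi x) - (b x)%:C) < e.

Lemma bump_bounded_support a r : 0 <= r -> bounded_support (bumpfun a r).
Proof.
move=> r0; exists (`|a| + r) => x xM; apply: bump_out => //.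
rewrite -(lerD2l `|a|) (le_trans xM)// addrC -[X in `|X|](subrK a).
exact: ler_normD.
Qed.

Lemma bounded_supportD b c : bounded_support b -> bounded_support c ->
  bounded_support (fun x => b x + c x).
Proof.
move=> [M HM] [N HN]; exists (Num.max M N) => x.
by rewrite ge_max => /andP[/HM -> /HN ->]; rewrite addr0.
Qed.

Lemma bounded_supportZ k b : bounded_support b ->
  bounded_support (fun x => k * b x).
Proof. by move=> [M HM]; exists M => x /HM ->; rewrite mulr0. Qed.

Lemma normcR r : normc r%:C = `|r|.
Proof. by rewrite /= expr0n /= addr0 sqrtr_sqr. Qed.

Lemma normcB z r e : normc (z - r%:C) < e -> `|normc z - `|r| | < e.
Proof.
move=> ze; apply: le_lt_trans ze; rewrite ler_norml -normcR.
apply/andP; split.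
  rewrite lerNl opprB lerBlDr addrC.
  have -> : normc r%:C = normc (- (- z + (z - r%:C))) by rewrite addKr opprK.
  rewrite normcN; apply: le_trans (le_normcD _ _) _.
  by rewrite normcN.
rewrite lerBlDr.
by rewrite -{1}[z](subrK r%:C); exact: le_normcD.
Qed.

(** The bump at a and the sum of the bumps at a and at a third point c both
separate a from b, which forces n = 0 in their approximations. The ratio
f c / f a would then have to be both small and close to 1. *)
Lemma approx_inj phi f : uniformly_approximates phi f -> injective phi.
Proof.
move=> Hf a b ab; apply/eqP/negPn/negP => aNb.
pose r : R := `|a - b|; have r0 : 0 < r by rewrite normr_gt0 subr_eq0.
pose c := Num.max a b + r.
have far (p q : R) : p + r <= q -> bumpfun p r q = 0 /\ bumpfun q r p = 0.
  rewrite -lerBrDl => rpq; have rN : r <= `|q - p| by rewrite (le_trans rpq)// ler_norm.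
  by split; apply: bump_out; rewrite ?(ltW r0)// distrC.
have ba : bumpfun a r b = 0 by rewrite bump_out ?(ltW r0)// distrC.
have [ca ac] : bumpfun a r c = 0 /\ bumpfun c r a = 0.
  by apply: far; rewrite lerD2r le_max lexx.
have [_ bc] : bumpfun b r c = 0 /\ bumpfun c r b = 0.
  by apply: far; rewrite lerD2r le_max lexx orbT.
have n0 (k : R[i]) n (g : R -> R) :
    (forall x, normc (k * f (iter n phi x) - (g x)%:C) < 4^-1) ->
    g a = 1 -> g b = 0 -> n = 0%N.
  case: n => // n H ga gb; have := H a; have := H b.
  rewrite !iterSr -ab ga gb => /normcB + /normcB.
  by rewrite normr0 normr1 !ltr_norml => ? ?; exfalso; lra.
have e0 : 0 < 4^-1 :> R by lra.
have [l [n Hl]] := Hf _ _ (@bump_smooth R a r) (bump_bounded_support a (ltW r0)) e0.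
have [m [k Hm]] := Hf _ _ (smoothD (@bump_smooth R a r) (@bump_smooth R c r))
  (bounded_supportD (bump_bounded_support a (ltW r0)) (bump_bounded_support c (ltW r0))) e0.
have nE := n0 _ _ _ Hl (bump_center a r0) ba.
have kE : k = 0%N by apply: (n0 _ _ _ Hm); rewrite ?ac ?ba ?bc ?bump_center// addr0.
subst n k; move: (Hl a) (Hl c) (Hm a) (Hm c) => /=.
rewrite ac ca !bump_center// addr0 add0r => /normcB + /normcB + /normcB + /normcB.
rewrite normr0 normr1 !ltr_norml !normcM.
move: (normc_ge0 l) (normc_ge0 m) (normc_ge0 (f a)) (normc_ge0 (f c)).
move: (normc l) (normc m) (normc (f a)) (normc (f c)) => L M A C.
move=> L0 M0 A0 C0 /andP[h1 _] /andP[_ h2] /andP[_ h3] /andP[h4 _].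
(* With error 1/4 the products |l f a| |m f c| >= 9/16 and |l f c| |m f a| <= 5/16
   of the same four factors differ. *)
have : (3/4) * (3/4) <= (L * A) * (M * C).
  by apply: ler_pM; lra.
have : (L * C) * (M * A) <= (1/4) * (5/4).
  by apply: ler_pM; rewrite ?mulr_ge0//; lra.
have -> : (L * C) * (M * A) = (L * A) * (M * C) by ring.
lra.
Qed.

(** A proper map bounded below tends to +oo at both ends, so it takes each large
value on either side of 0. *)
Lemma proper_fold phi c : continuous phi -> proper_map phi ->
  (forall x, c < phi x) -> exists a b : R, a != b /\ phi a = phi b.
Proof.
move=> cphi pphi Hc.
pose M := `|phi 0| + `|c| + 1.
have M0 : 0 < M by rewrite ltr_wpDl// addr_ge0.
have [_/posnumP[B] HB] := pinfty_ex_gt0 (pphi M M0).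
have big x : B%:num < `|x| -> M < phi x.
  move=> Bx; rewrite ltNge; apply/negP => phixM.
  suff /HB : (phi @^-1` `[- M, M]) x by rewrite /= leNgt Bx.
  rewrite /= in_itv /= phixM andbT.
  apply: le_trans (ltW (Hc x)); rewrite lerNl.
  by rewrite (le_trans (ler_norm _))// normrN /M; have := normr_ge0 (phi 0); lra.
have phi0M : phi 0 < M.
  by rewrite (le_lt_trans (ler_norm _))// /M; have := normr_ge0 c; lra.
have B1 : 0 < B%:num + 1 by rewrite addr_gt0.
have hp : M < phi (B%:num + 1) by apply: big; rewrite gtr0_norm// ltrDl.
have hn : M < phi (- (B%:num + 1)).
  by apply: big; rewrite normrN gtr0_norm// ltrDl.
have cw (a b : R) : {within `[a, b], continuous phi} by exact: continuous_subspaceT.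
have nB0 : - (B%:num + 1) <= 0 by rewrite oppr_le0 ltW.
have [|a + aM] := IVT nB0 (cw _ _) (v := M).
  by rewrite ge_min le_max (ltW phi0M) (ltW hn) orbT.
have [|b + bM] := IVT (ltW B1) (cw _ _) (v := M).
  by rewrite ge_min le_max (ltW phi0M) (ltW hp) orbT.
rewrite !in_itv /= => /andP[b0 _] /andP[_ a0].
exists a, b; split; last by rewrite aM bM.
apply/eqP => ab; have a00 : a = 0 by apply/eqP; rewrite eq_le a0 ab.
by move: phi0M; rewrite -aM a00 ltxx.
Qed.

Lemma proper_inj_surj phi : continuous phi -> proper_map phi ->
  injective phi -> forall y, exists x, phi x = y.
Proof.
move=> cphi pphi iphi y; apply: contrapT => /forallNP Hy.
have [a [b [/eqP aNb ab]]] : exists a b : R, a != b /\ phi a = phi b; last first.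
  by apply: aNb; exact: iphi.
have cw (a b : R) : {within `[a, b], continuous phi} by exact: continuous_subspaceT.
have noIVT (a b : R) : ~ (phi a < y /\ y < phi b).
  move=> [ay yb]; have [ab|/ltW ba] := leP a b.
    have [|x _ /Hy//] := IVT ab (cw _ _) (v := y).
    by rewrite ge_min le_max (ltW ay) (ltW yb) orbT.
  have [|x _ /Hy//] := IVT ba (cw _ _) (v := y).
  by rewrite ge_min le_max (ltW ay) (ltW yb) orbT.
have [y0|y0|/Hy//] := ltgtP (phi 0) y.
- have [||x|a [b [aNb ab]]] := @proper_fold (fun x => - phi x) (- y).
  + by move=> x; apply: cvgN; exact: cphi.
  + move=> M M0; have := pphi M M0.
    congr (bounded_set _); apply/seteqP; split=> x /=;
      by rewrite !in_itv /= lerN2 lerNl andbC.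
  + rewrite ltrN2; case: (ltgtP (phi x) y) => // [xy|/Hy//].
    by case: (noIVT 0 x).
  + by exists a, b; split=> //; apply: oppr_inj.
- have [|a [b ?]] := @proper_fold phi y cphi pphi; last by exists a, b.
  move=> x; case: (ltgtP (phi x) y) => // [xy|/Hy//].
  by case: (noIVT x 0).
Qed.

(** Let l f be close to the range [0, 1] of a bump and m f to the range of a
difference of two bumps, with m f y close to 1 and m f z to -1. Then
|m (f y + f z)| is small. But l f y and l f z are close to nonnegative reals, so
that |l (f y + f z)| is at least about |l f y|. As both ranges have the same
largest modulus, |l| and |m| are comparable, which is a contradiction. *)
Lemma approx_nsurj phi f : uniformly_approximates phi f ->
  ~ (forall y, exists x, phi x = y).
Proof.
move=> Hf sphi.
have siter n y : exists x, iter n phi x = y.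
  elim: n y => [|n IH] y; first by exists y.
  by have [x xy] := sphi y; have [w wx] := IH x; exists w; rewrite iterS wx.
have r0 : 0 < 1 :> R by [].
have e0 : 0 < 10^-1 :> R by lra.
pose g (x : R) : R := bumpfun 0 1 x + (-1) * bumpfun 2 1 x.
have sg : smooth g.
  by apply: smoothD; [|apply: smoothZ]; exact: bump_smooth.
have cg : bounded_support g.
  by apply: bounded_supportD; [|apply: bounded_supportZ]; exact: bump_bounded_support.
have g0 : g 0 = 1.
  by rewrite /g bump_center// bump_out// ?mulr0 ?addr0// sub0r normrN ger0_norm ?ler1n.
have g2 : g 2 = -1.
  by rewrite /g bump_center// bump_out// ?mulr1 ?add0r// subr0 ger0_norm ?ler1n.
have gle x : `|g x| <= 1.
  rewrite ler_norml /g; have := bump_ge0 0 1 x; have := bump_ge0 2 1 x.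
  by have := bump_le1 0 x r0; have := bump_le1 2 x r0; lra.
have [l [n Hl]] := Hf _ _ (@bump_smooth R 0 1) (bump_bounded_support 0 ler01) e0.
have [m [k Hm]] := Hf _ _ sg cg e0.
have fl y : exists2 s, 0 <= s & normc (l * f y - s%:C) < 10^-1.
  have [x <-] := siter n y; exists (bumpfun 0 1 x) => //; exact: bump_ge0.
have fm y : normc (m * f y) < 11/10.
  have [x <-] := siter k y; have := normcB (Hm x); rewrite ltr_norml.
  by have := gle x; lra.
have f0 := normcB (Hl 0); rewrite bump_center// normr1 in f0.
set w := iter n phi 0 in f0.
have := Hm 0; have := Hm 2; rewrite g0 g2.
set y := iter k phi 0; set z := iter k phi 2 => Hz Hy.
have myz : normc (m * (f y + f z)) < 2/10.
  have -> : m * (f y + f z) = (m * f y - 1%:C) + (m * f z - (-1)%:C).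
    by rewrite rmorphN /=; ring.
  by apply: le_lt_trans (le_normcD _ _) _; lra.
have [s s0 Hs] := fl y; have [t t0 Ht] := fl z.
have lyz : normc (l * f y) - 3/10 < normc (l * (f y + f z)).
  have st : normc (l * (f y + f z) - (s + t)%:C) < 2/10.
    have -> : l * (f y + f z) - (s + t)%:C =
        (l * f y - s%:C) + (l * f z - t%:C) by rewrite rmorphD /=; ring.
    by apply: le_lt_trans (le_normcD _ _) _; lra.
  move: (normcB st) (normcB Hs); rewrite (ger0_norm (addr_ge0 s0 t0)) (ger0_norm s0).
  by rewrite !ltr_norml; lra.
move: (fm w) f0 (normcB Hy) lyz myz; rewrite normr1 !ltr_norml !normcM.
move: (normc_ge0 l) (normc_ge0 m) (normc_ge0 (f w)).
move: (normc l) (normc m) (normc (f w)) (normc (f y)) (normc (f y + f z)).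
move=> L M W Y A L0 M0 W0 h1 /andP[h2 _] /andP[h3 _] h4 h5.
(* In terms of the moduli: M <= (11/9) L because both multiples of f have maximal
   modulus within 1/10 of 1, and L * (9/10) - M * (3/10) <= L * (2/10). *)
have Lp : 0 < L.
  by rewrite lt_neqAle L0 andbT; apply: contraTneq h2 => <-; lra.
have ML : M * (9/10) <= L * (11/10).
  have a1 : M * (9/10) <= M * (L * W) by rewrite ler_wpM2l//; lra.
  have a2 : L * (M * W) <= L * (11/10) by rewrite ler_wpM2l// ltW.
  by apply: le_trans a1 _; rewrite mulrCA.
have b1 : M * (L * Y - 3/10) <= M * (L * A) by rewrite ler_wpM2l// ltW.
have b2 : L * (9/10) <= L * (M * Y) by rewrite ler_wpM2l//; lra.
have b3 : L * (M * A) <= L * (2/10) by rewrite ler_wpM2l// ltW.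
have E1 : M * (L * Y - 3/10) = L * (M * Y) - M * (3/10) by ring.
have E2 : M * (L * A) = L * (M * A) by ring.
lra.
Qed.

Lemma proper_not_approx phi f : continuous phi -> proper_map phi ->
  ~ uniformly_approximates phi f.
Proof.
move=> cphi pphi Hf; apply: (approx_nsurj Hf).
exact: proper_inj_surj cphi pphi (approx_inj Hf).
Qed.

End approximation.

(** * Test functions, Schwartz functions and their topologies *)

Section function_spaces.
Context {R : realType}.
Implicit Types (phi b : R -> R) (u : R -> R[i]).

Lemma bounded_support_testfun b : smooth b -> bounded_support b ->
  is_testfun (fun x => (b x)%:C).
Proof.
move=> sb [M HM]; split; first by split=> //; exact: smooth_cst.
apply: (subclosed_compact _ (segment_compact (a := - M) (b := M))).
  exact: closed_closure.
have /closure_id -> : closed [set` `[- M, M]%R] by exact: itv_closed.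
apply: closure_subset => x /= bx; rewrite in_itv /= -ler_norml leNgt.
by apply: contra_neqN bx => /ltW /HM ->.
Qed.

Lemma cderive1n_outside u n x : ~ csupport u x -> cderive1n n u x = 0.
Proof.
have cl : closed (csupport u) by exact: closed_closure.
move=> ux; rewrite /cderive1n !(derive1n_outside n cl) //;
  by move=> y /csupportP ->.
Qed.

Lemma testfun_schwartz u : is_testfun u -> is_schwartz u.
Proof.
move=> tu; have [su cu] := tu; split=> // n.
have /pinfty_ex_gt0[M M0 HM] := compact_bounded cu.
have := is_testfun_lty n tu; rewrite /testfun_seminorm.
have := @wsup_ge0 _ (fun=> 1) (fun=> ler01) n u.
have := fun j x jn => @wsup_ge _ (fun=> 1) j n u x jn.
case: (wsup _ _ _) => [B||]// HB; rewrite lee_fin => B0 _.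
apply: (@le_lt_trans _ _ ((1 + M ^+ 2) ^+ n * B)%:E); last exact: ltry.
apply: wsup_le => j x jn; rewrite lee_fin.
have [ux|ux] := pselect (csupport u x); last first.
  rewrite cderive1n_outside// normc0 mulr0 mulr_ge0// exprn_ge0// addr_ge0//.
  by rewrite exprn_ge0// ltW.
apply: ler_pM; rewrite ?normc_ge0 ?exprn_ge0 ?addr_ge0 ?exprn_ge0//.
  rewrite lerXn2r ?nnegrE ?addr_ge0 ?exprn_ge0// ?(ltW M0)// lerD2l.
  by rewrite lerXn2r ?nnegrE// ?(ltW M0)//; exact: HM.
by have := HB j x jn; rewrite mul1r.
Qed.

Lemma wsup0_lt w u e : (forall x, 1 <= w x) ->
  (wsup w 0 u < e%:E)%E -> forall x, normc (u x) < e.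
Proof.
move=> w1 ue x; have := le_lt_trans (wsup_ge w u x (leqnn 0)) ue.
rewrite lte_fin; apply: le_lt_trans.
rewrite (_ : cderive1n 0 u x = u x); last by rewrite /cderive1n /=; case: (u x).
by rewrite ler_peMl ?normc_ge0.
Qed.

(** Stated for an abstract E, with [ev] the underlying function of an element, so
as to serve both function spaces. The third premise is all that is asked of the
topology of E: it refines uniform convergence at enough elements. *)
Lemma supercyclic_approximates (E : tvsType R[i]) (ev : E -> R -> R[i])
    (T : {linear E -> E}) phi :
  (forall a f x, ev (a *: f) x = a * ev f x) ->
  (forall f x, ev (T f) x = ev f (phi x)) ->
  (forall b, smooth b -> bounded_support b -> exists g : E, forall e, 0 < e ->
     nbhs g [set h : E | forall x, normc (ev h x - (b x)%:C) < e]) ->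
  supercyclic T -> exists f, uniformly_approximates phi f.
Proof.
move=> evZ evT evb [f df]; exists (ev f) => b e sb cb e0.
have [g /(_ e e0) gA] := evb b sb cb.
have Ane : (interior [set h : E | forall x, normc (ev h x - (b x)%:C) < e]) !=set0.
  by exists g; exact: gA.
have [h [/interior_subset Ah [l _ [n _ hE]]]] := df _ Ane (@open_interior _ _).
exists l, n => x.
have evn k y : ev (iter k T f) y = ev f (iter k phi y).
  by elim: k y => [//|k IH] y; rewrite iterS evT IH -iterSr.
by rewrite -evn -evZ hE; exact: Ah.
Qed.

Lemma schwartz_nbhs_uniform b : smooth b -> bounded_support b ->
  exists g : schwartz R, forall e, 0 < e ->
    nbhs g [set h : schwartz R | forall x, normc (h x - (b x)%:C) < e].
Proof.
move=> sb cb.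
have sg := testfun_schwartz (bounded_support_testfun sb cb).
exists (Schwartz (asboolT sg)) => e e0; apply/schwartz_nbhsE.
exists 0%N, e => // h he x.
rewrite -[(_ + h) x]/((b x)%:C + h x) addrC addKr.
by apply: wsup0_lt he x => x; rewrite expr0.
Qed.

Lemma testfun_nbhs_uniform b : smooth b -> bounded_support b ->
  exists g : testfun R, forall e, 0 < e ->
    nbhs g [set h : testfun R | forall x, normc (h x - (b x)%:C) < e].
Proof.
move=> sb cb; have tg := bounded_support_testfun sb cb.
exists (Testfun (asboolT tg)) => e e0; apply/testfun_nbhsE.
exists [set h : testfun R | (testfun_seminorm 0 h < e%:E)%E]; last first.
  move=> h he x; rewrite -[(_ + h) x]/((b x)%:C + h x) addrC addKr.
  exact: wsup0_lt he x.
split.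
- move=> f g t; rewrite !inE => fe ge.
  have [sf _] := testfunP f; have [sg' _] := testfunP g.
  exact: (wsup_convex (fun=> ler01) t sf sg' fe ge).
- move=> a f a1 fe; have [sf _] := testfunP f.
  apply: le_lt_trans (wsupZ _ 0 a sf) _; apply: le_lt_trans fe.
  by rewrite gee_pMl// ?wsup_ge0// lee_fin -lecR -Defs.normcE.
- by move=> K _; exists 0%N, e.
Qed.

(** Let b be a bump positive on [-M, M], with minimum b c there. Where phi takes
values in [-M, M], b o phi is at least b c; as (1 + x^2) b (phi x) is bounded,
this confines x. *)
Lemma symbol_proper phi : schwartz_symbol phi -> proper_map phi.
Proof.
move=> [sphi hphi _] M M0.
pose b := bumpfun 0 (M + 1).
have M1 : 0 < M + 1 by rewrite ltr_wpDl// ltW.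
have sb : smooth b := @bump_smooth R 0 (M + 1).
have cb : bounded_support b by exact: bump_bounded_support (ltW M1).
have tb := testfun_schwartz (bounded_support_testfun sb cb).
have [_ /(_ 1%N)] := hphi (Schwartz (asboolT tb)).
set S := schwartz_seminorm _ _ => Sy.
have MM : - M <= M by lra.
have [|c cM Hc] := @EVT_min _ b (- M) M MM.
  by apply: continuous_subspaceT; exact: (smooth_continuous (n := 0) sb).
have d0 : 0 < b c.
  apply: bump_gt0; rewrite subr0 (@le_lt_trans _ _ M) ?ltrDl//.
  by move: cM; rewrite in_itv /= -ler_norml.
have [C HC] : exists C, forall x, phi x \in `[- M, M]%R -> `|x| <= C.
  have : S \is a fin_num.
    rewrite ge0_fin_numE//; apply: wsup_ge0 => x.
    by rewrite exprn_ge0// addr_ge0// exprn_ge0.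
  move=> /fineK SE; exists (fine S / b c) => x xM; rewrite ler_pdivlMr//.
  rewrite -lee_fin SE.
  apply: le_trans (@wsup_ge _ (fun x => (1 + `|x| ^+ 2) ^+ 1) 0 1 _ x _) => //.
  rewrite /cderive1n /= lee_fin expr1.
  rewrite expr0n addr0 sqrtr_sqr (ger0_norm (bump_ge0 _ _ _)) ler_pM ?(ltW d0) ?Hc//.
  have := sqr_ge0 (`|x| - 1); have := normr_ge0 x.
  by rewrite sqrrB1; lra.
exists C; split; first exact: num_real.
by move=> N CN x /= /HC xC; rewrite (le_trans xC)// ltW.
Qed.

End function_spaces.

Theorem corollary2p2 (R : realType) :
  (forall (phi : R -> R) (hphi : schwartz_symbol phi),
      ~ supercyclic (schwartz_comp (symbol_comp hphi))) /\
  (forall (phi : R -> R) (sphi : smooth phi) (pphi : proper_map phi),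
      ~ supercyclic (testfun_comp sphi pphi)).
Proof.
split=> phi.
  move=> hphi.
  have cphi : continuous phi := smooth_continuous (n := 0) (symbol_smooth hphi).
  move=> /(@supercyclic_approximates _ _ (@schwartz_fun R) _ phi).
  case=> // [|f]; first exact: schwartz_nbhs_uniform.
  exact: proper_not_approx cphi (symbol_proper hphi).
move=> sphi pphi.
have cphi : continuous phi := smooth_continuous (n := 0) sphi.
move=> /(@supercyclic_approximates _ _ (@testfun_fun R) _ phi).
case=> // [|f]; first exact: testfun_nbhs_uniform.
exact: proper_not_approx cphi pphi.
Qed.
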